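(* Let $G$ be a finitely presented group. If there is a bushy pseudocharacter (not identically zero) on $G$, then $G$ contains a non-abelian free subgroup.
   Context: **Pseudocharacters.** A function $f\colon G\to\mathbb{R}$ is a pseudocharacter if $f(\alpha^n)=nf(\alpha)$ for all $\alpha\in G$, $n\in\mathbb{Z}$, and there is a constant $C$ with $|f(\alpha)+f(\beta)-f(\alpha\beta)|\le C$ for all $\alpha,\beta\in G$. **The set $E(f)$.** Let $S$ be a finite triangular generating set of $G$, i.e. $G$ has a finite presentation $\langle S\mid R\rangle$ in which every word of $R$ has length three (every finitely presented group has such a presentation). Let $\Gamma(G,S)$ be the Cayley graph (edges joining $g$ to $gs$, each of length one, $G$ acting on the left), and extend $f$ affinely over its edges. For a continuous $\phi\colon\mathbb{R}_+=[0,\infty)\to\Gamma(G,S)$ put $\sigma(\phi)=+1$ if $\lim_{t\to\infty}f(\phi(t))=\infty$, $\sigma(\phi)=-1$ if $\lim_{t\to\infty}f(\phi(t))=-\infty$, and $\sigma(\phi)=0$ otherwise. For $C>0$ write $\phi_1\sim_C\phi_2$ if $\sigma(\phi_1)=\sigma(\phi_2)$ and for every $D$ with $\sigma(\phi_1)D>C$ there is a path $\delta\colon[0,1]\to\Gamma(G,S)$ with $\delta(0)\in\phi_1(\mathbb{R}_+)$, $\delta(1)\in\phi_2(\mathbb{R}_+)$ and $|f(\delta(t))-D|\le C$ for all $t\in[0,1]$. Write $\phi_1\sim\phi_2$ if $\phi_1\sim_C\phi_2$ for some $C$. Then $E(f)=E(f,S)$ is the set of $\sim$-classes of continuous $\phi$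 with $\sigma(\phi)\in\{+1,-1\}$; up to canonical bijection it does not depend on $S$. Let $E(f)^{+}$, $E(f)^-$ be the subsets of classes with $\sigma(\phi)=+1$, resp. $-1$. **Types.** $f$ is *uniform* if $|E(f)|=2$; *unipotent* if $|E(f)^+|=1$ or $|E(f)^-|=1$ but $f$ is not uniform; and *bushy* otherwise. *)

(* Defs.v *)
From HB Require Import structures.
From mathcomp Require Import all_boot all_order all_algebra.
From mathcomp Require Import all_classical all_reals all_analysis.

Set Implicit Arguments.
Unset Strict Implicit.
Unset Printing Implicit Defensive.

Import Order.TTheory GRing.Theory Num.Theory numFieldNormedType.Exports.

Local Open Scope classical_set_scope.
Local Open Scope card_scope.
Local Open Scope ring_scope.

(* The letter [(x, false)] stands for x and [(x, true)] for its inverse. *)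
Definition word (X : Type) : Type := seq (X * bool).

(* Equality in the group < X | Rel >: the congruence on words generated by free
   cancellation and by the relators.  For [Rel := set0] this is equality in the
   free group on X. *)
Inductive word_eq (X : Type) (Rel : set (word X)) : word X -> word X -> Prop :=
| word_eq_refl w : word_eq Rel w w
| word_eq_sym v w : word_eq Rel v w -> word_eq Rel w v
| word_eq_trans u v w : word_eq Rel u v -> word_eq Rel v w -> word_eq Rel u w
| word_eq_cancel u v x b :
    word_eq Rel (u ++ [:: (x, b); (x, ~~ b)] ++ v) (u ++ v)
| word_eq_relator u v r : Rel r -> word_eq Rel (u ++ r ++ v) (u ++ v).

Definition word_val (G : groupType) (X : set G) (w : word X) : G :=
  foldr (fun (l : X * bool) (g : G) =>
    ((if l.2 then (\val l.1)^-1 else \val l.1) * g)%g) 1%g w.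

(* The subset X of G generates the subgroup H, and the evaluation of words
   induces an isomorphism from < X | Rel > onto H. *)
Definition presents (G : groupType) (X : set G) (Rel : set (word X))
    (H : set G) : Prop :=
  range (@word_val G X) = H /\
  forall v w : word X, word_val v = word_val w <-> word_eq Rel v w.

Definition finitely_presented (G : groupType) : Prop :=
  exists (S : set G) (Rel : set (word S)),
    [/\ finite_set S, finite_set Rel & presents Rel setT].

Definition triangular_generating_set (G : groupType) (S : set G) : Prop :=
  finite_set S /\
  exists Rel : set (word S),
    [/\ finite_set Rel, forall r, Rel r -> size r = 3%N & presents Rel setT].

Definition free_subgroup (G : groupType) (H : set G) : Prop :=
  exists X : set G, presents (set0 : set (word X)) H.

Definition zexpg (G : groupType) (x : G) (n : int) : G :=
  match n with Posz m => (x ^+ m)%g | Negz m => (x ^- m.+1)%g end.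

Definition pseudocharacter (R : realType) (G : groupType) (f : G -> R) : Prop :=
  (forall (a : G) (n : int), f (zexpg a n) = n%:~R * f a) /\
  exists C : R, forall a b : G, `|f a + f b - f (a * b)%g| <= C.

(* The points of the Cayley graph: [Edge g s t] is the point at distance t from
   g in the open edge from g to g s. *)
Inductive cayley (R : realType) (G : groupType) (S : set G) : Type :=
| Vertex of G
| Edge (g : G) (s : S) (t : R) of 0 < t < 1.

Arguments Vertex {R G S} _.
Arguments Edge {R G S} g s t _.

HB.instance Definition _ (R : realType) (G : groupType) (S : set G) :=
  gen_eqMixin (cayley R S).
HB.instance Definition _ (R : realType) (G : groupType) (S : set G) :=
  gen_choiceMixin (cayley R S).

Section cayley_topology.
Context {R : realType} {G : groupType} {S : set G}.

(* The parametrization of the closed edge from g to g s by [0, 1], extended to R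
   by constants on both sides. *)
Definition edge_map (g : G) (s : S) (t : R) : cayley R S :=
  match boolP (0 < t < 1) with
  | AltTrue t01 => Edge g s t t01
  | AltFalse _ => if t <= 0 then Vertex g else Vertex (g * \val s)%g
  end.

(* The quotient topology of the disjoint union of the closed edges (and of the
   discrete set of vertices); as R retracts onto [0, 1], openness can be tested
   on R.  For finite S it is the topology of the path metric. *)
Definition cayley_open (U : set (cayley R S)) : Prop :=
  forall (g : G) (s : S), open (edge_map g s @^-1` U).

Let cayley_openT : cayley_open setT.
Proof. by move=> g s; rewrite preimage_setT; exact: openT. Qed.

Let cayley_openI (U V : set (cayley R S)) :
  cayley_open U -> cayley_open V -> cayley_open (U `&` V).
Proof. by move=> oU oV g s; rewrite preimage_setI; exact: openI. Qed.

Let cayley_open_bigcup (I : Type) (U : I -> set (cayley R S)) :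
  (forall i, cayley_open (U i)) -> cayley_open (\bigcup_i U i).
Proof.
by move=> oU g s; rewrite preimage_bigcup; apply: bigcup_open => i _; exact: oU.
Qed.

HB.instance Definition _ := isOpenTopological.Build (cayley R S)
  cayley_openT cayley_openI cayley_open_bigcup.

End cayley_topology.

Section ends.
Context {R : realType} {G : groupType} {S : set G}.
Context (f : G -> R).

Definition affine_ext (p : cayley R S) : R :=
  match p with
  | Vertex g => f g
  | Edge g s t _ => (1 - t) * f g + t * f (g * \val s)%g
  end.

(* A map phi : [0, +oo[ -> cayley R S is represented by a function on R, of which
   only the values on [0, +oo[ matter; similarly for paths on [0, 1]. *)
Definition continuous_ray (phi : R -> cayley R S) : Prop :=
  {within `[0, +oo[, continuous phi}.

Definition sigma (phi : R -> cayley R S) : R :=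
  if `[< affine_ext (phi t) @[t --> +oo] --> +oo >] then 1
  else if `[< affine_ext (phi t) @[t --> +oo] --> -oo >] then -1
  else 0.

Definition ray_sim_at (C : R) (phi1 phi2 : R -> cayley R S) : Prop :=
  sigma phi1 = sigma phi2 /\
  forall D : R, C < sigma phi1 * D ->
    exists delta : R -> cayley R S,
      [/\ {within `[0, 1], continuous delta},
          (phi1 @` `[0, +oo[) (delta 0),
          (phi2 @` `[0, +oo[) (delta 1) &
          forall t : R, 0 <= t <= 1 -> `|affine_ext (delta t) - D| <= C].

Definition ray_sim (phi1 phi2 : R -> cayley R S) : Prop :=
  exists2 C : R, 0 < C & ray_sim_at C phi1 phi2.

Definition ray_class (phi : R -> cayley R S) : set (R -> cayley R S) :=
  [set psi | continuous_ray psi /\ ray_sim phi psi].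

Definition E_set : set (set (R -> cayley R S)) :=
  [set ray_class phi | phi in
    [set phi | continuous_ray phi /\ (sigma phi = 1 \/ sigma phi = -1)]].

Definition E_pos : set (set (R -> cayley R S)) :=
  [set ray_class phi | phi in
    [set phi | continuous_ray phi /\ sigma phi = 1]].

Definition E_neg : set (set (R -> cayley R S)) :=
  [set ray_class phi | phi in
    [set phi | continuous_ray phi /\ sigma phi = -1]].

End ends.

Definition uniform_type (R : realType) (G : groupType) (S : set G)
    (f : G -> R) : Prop :=
  E_set (S := S) f #= `I_2.

Definition unipotent_type (R : realType) (G : groupType) (S : set G)
    (f : G -> R) : Prop :=
  (E_pos (S := S) f #= `I_1 \/ E_neg (S := S) f #= `I_1) /\ ~ uniform_type S f.

Definition bushy_type (R : realType) (G : groupType) (S : set G)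
    (f : G -> R) : Prop :=
  ~ uniform_type S f /\ ~ unipotent_type S f.

(* Main.v *)
Require Import Defs.
From mathcomp Require Import all_boot all_order all_algebra.
From mathcomp Require Import all_classical all_reals all_analysis.
From mathcomp Require Import ring lra.

Set Implicit Arguments.
Unset Strict Implicit.
Unset Printing Implicit Defensive.

Import Order.TTheory GRing.Theory Num.Theory numFieldNormedType.Exports.

Local Open Scope classical_set_scope.
Local Open Scope card_scope.
Local Open Scope ring_scope.

(** The proof is a ping-pong argument on the level sets of [f], which behave like
    the levels of a tree because the Cayley complex is simply connected.

    The topological input is [potential].  A level [D] is crossed by the edges whose
    ends lie on different sides of it; all of these run in a narrow band around [D].
    If [K] is a union of connected components of the band, then the signed crossings
    of [D] within [K] are a cochain on the edges.  The three vertices of a triangle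
    that is crossed lie in one component, so the cochain is closed on triangles, and
    as all relators are triangles it is the coboundary of a function on [G]
    ([exact_cochain]).  Consequently a path that crosses the level [D] only within
    [K], and from below to above, has ends that are separated by [K] ([separation]).

    Let [f g > 0].  The orbits [x g^n] climb to the levels [f = +oo], and they
    represent points of [E_pos f]; [same_end] is the corresponding relation.
    Suppose that all these orbits had the same end.  Two rays [phi] and [psi] that
    climb to [+oo] start in a common component of a sublevel set, and they end in a
    common component of the part above [D], namely the one that contains the ends of
    all orbits.  If they did not meet the same component of the band at [D], then the
    potential of the components met by [phi] would increase by one along [phi] but
    not along [psi].  So [E_pos f] would have only one element ([E_pos_singleton]).
    The same holds for [E_neg f], that is for [- f] and [g^-1].  A bushy [f] thus
    yields an element that moves the end of [g] in [E_pos f] and one that moves the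
    end of [g^-1] in [E_neg f].  The stabilizers of these ends are proper subgroups,
    and a group is not the union of two proper subgroups, so that some [k] moves
    both ends.

    The axes of [g] and of its conjugate by [k] are therefore disjoint at some high
    level and at some low level.  The components of these two levels that meet the
    axes are four disjoint walls, and each wall cuts off a half-space that does not
    contain the identity.  For large [n], [separation] shows that [g^n] maps the
    complement of the half-space at its negative end into the one at its positive end
    ([wall_shift]), and similarly for the inverse and for the conjugate.  By ping-pong
    [g^n] and [k g^n k^-1] freely generate a free group. *)

(** * Edge paths in the Cayley graph *)

Section paths.
Context {G : groupType} (S : set G).

Definition letter (l : S * bool) : G :=
  (if l.2 then (\val l.1)^-1 else \val l.1)%g.

Definition flip (l : S * bool) : S * bool := (l.1, ~~ l.2).

Lemma letter_flip l : letter (flip l) = ((letter l)^-1)%g.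
Proof. by case: l => s [] //=; rewrite /letter /= invgK. Qed.

Definition adj (x y : G) : Prop := exists l, y = (x * letter l)%g.

Lemma adj_sym x y : adj x y -> adj y x.
Proof. by case=> l ->; exists (flip l); rewrite letter_flip mulgK. Qed.

Lemma adj_mull z x y : adj x y -> adj (z * x)%g (z * y)%g.
Proof. by case=> l ->; exists l; rewrite mulgA. Qed.

Inductive reach (P : set G) (x : G) : G -> Prop :=
| reach_refl : P x -> reach P x x
| reach_step y z : reach P x y -> adj y z -> P z -> reach P x z.

Lemma reach_start P x y : reach P x y -> P x.
Proof. by elim. Qed.

Lemma reach_end P x y : reach P x y -> P y.
Proof. by case. Qed.

Lemma reach_edge (P : set G) x y : adj x y -> P x -> P y -> reach P x y.
Proof. by move=> xy Px Py; apply: reach_step xy Py; exact: reach_refl. Qed.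

Lemma reach_trans P x y z : reach P x y -> reach P y z -> reach P x z.
Proof.
by move=> xy; elim=> // {}z t _ xz zt Pt; exact: reach_step zt Pt.
Qed.

Lemma reach_sym P x y : reach P x y -> reach P y x.
Proof.
elim=> [Px|{}y z xy yx yz Pz]; first exact: reach_refl.
apply: reach_trans yx; apply: reach_edge (adj_sym yz) Pz _.
exact: reach_end xy.
Qed.

Lemma reach_sub (P Q : set G) x y :
  (forall z, P z -> Q z) -> reach P x y -> reach Q x y.
Proof.
move=> PQ; elim=> [Px|{}y z _ xy yz Pz]; first by apply: reach_refl; exact: PQ.
by apply: reach_step xy yz _; exact: PQ.
Qed.

Lemma reach_mull (P Q : set G) a x y :
  (forall z, P z -> Q (a * z)%g) -> reach P x y -> reach Q (a * x)%g (a * y)%g.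
Proof.
move=> PQ; elim=> [Px|{}y z _ xy yz Pz]; first by apply: reach_refl; exact: PQ.
by apply: reach_step xy (adj_mull _ yz) _; exact: PQ.
Qed.

Lemma reach_reach P x y : reach P x y -> reach (reach P x) x y.
Proof.
elim=> [Px|{}y z xy IH yz Pz]; first by apply: reach_refl; exact: reach_refl.
by apply: (reach_step IH yz); exact: reach_step xy yz Pz.
Qed.

Lemma reach_exit (P Q : set G) x y :
  reach P x y -> reach Q x y \/ exists2 q, ~ Q q & reach P x q.
Proof.
elim=> [Px|{}y z xy [xyQ|?] yz Pz]; last by right.
  by have [Qx|nQx] := pselect (Q x); [left|right; exists x => //]; exact: reach_refl.
have [Qz|nQz] := pselect (Q z); first by left; exact: reach_step yz Qz.
by right; exists z => //; exact: reach_step yz Pz.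
Qed.

Lemma reach_const T (u : G -> T) (P : set G) x y :
  (forall a b, adj a b -> P a -> P b -> u a = u b) -> reach P x y -> u x = u y.
Proof.
move=> uP; elim=> // {}y z xy -> yz Pz; apply: uP => //; exact: reach_end xy.
Qed.

(** The sequence rests at [y] after its [n] steps, so that it has a continuous
    parametrization by the whole half-line. *)
Lemma reach_seq P x y : reach P x y ->
  exists v : nat -> G, exists n : nat, [/\ v 0%N = x, v n = y, forall i, P (v i) &
    forall i, v i.+1 = v i \/ adj (v i) (v i.+1)].
Proof.
elim=> [Px|{}y z xy [v [n [v0 vn vP vS]]] yz Pz].
  by exists (fun=> x), 0%N; split=> // i; left.
exists (fun i => if (i <= n)%N then v i else z), n.+1; split.
- by rewrite leq0n.
- by rewrite ltnn.
- by move=> i; case: ifP.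
- move=> i; case: (ltngtP i n) => [_|_|->]; [exact: vS|by left|].
  by right; rewrite vn.
Qed.

End paths.

(** * Simple connectivity *)

Section potential.
Context {G : groupType} (S : set G).
Hypothesis tri : triangular_generating_set S.

Lemma word_val_cat (v w : word S) :
  word_val (v ++ w) = (word_val v * word_val w)%g.
Proof. by elim: v => [|l v IH] /=; rewrite ?mul1g// IH mulgA. Qed.

Lemma word_val_onto (x : G) : exists w : word S, word_val w = x.
Proof.
have [_ [Rel [_ _ [rS _]]]] := tri.
by have : [set: G] x by []; rewrite -rS => -[w _ <-]; exists w.
Qed.

Lemma reachT x y : reach S setT x y.
Proof.
have [w <-] : exists w : word S, (x * word_val w)%g = y.
  by have [w wE] := word_val_onto (x^-1 * y)%g; exists w; rewrite wE mulVKg.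
elim: w x => [|l w IH] x /=; first by rewrite mulg1; exact: reach_refl.
rewrite mulgA; apply: reach_trans (IH _).
by apply: reach_edge => //; exists l.
Qed.

(** The sum of [w] along a word depends only on the value of the word, since
    inserting a relator means inserting a triangle; so the sum from the identity is a
    primitive.  This is the simple connectivity of the Cayley complex. *)
Lemma exact_cochain (w : G -> G -> int) :
  (forall x y, w y x = - w x y) ->
  (forall x y z, adj S x y -> adj S y z -> adj S z x ->
    w x y + w y z + w z x = 0) ->
  exists h : G -> int, forall x y, adj S x y -> h y - h x = w x y.
Proof.
move=> wN w3; have [_ [Rel [_ R3 [rS presS]]]] := tri.
pose fix om (x : G) (u : word S) : int :=
  if u is l :: u' then w x (x * letter l)%g + om (x * letter l)%g u' else 0.
have om_cat u v x : om x (u ++ v) = om x u + om (x * word_val u)%g v.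
  elim: u x => [|l u IH] x /=; first by rewrite mulg1 add0r.
  by rewrite IH addrA mulgA.
have om_eq u v : word_eq Rel u v -> forall x, om x u = om x v.
  elim=> [//|{}u {}v _ IH x|u1 u2 u3 _ IH1 _ IH2 x|u1 u2 s b x|u1 u2 r Rr x].
  - by rewrite IH.
  - by rewrite IH1 IH2.
  - rewrite !om_cat.
    have -> : word_val [:: (s, b); (s, ~~ b)] = 1%g.
      rewrite /= -/(letter (s, b)) -/(letter (flip (s, b))) letter_flip.
      by rewrite mulg1 mulgV.
    rewrite mulg1 /= addr0 -/(flip (s, b)) letter_flip mulgK.
    by rewrite [w (_ * letter _)%g _]wN subrr add0r.
  - have r1 : word_val r = 1%g.
      rewrite -[RHS]/(@word_val G S [::]); apply/presS.
      rewrite -[r]cats0 -[X in word_eq _ _ X]/([::] ++ [::]).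
      by rewrite -[r ++ [::]]/([::] ++ r ++ [::]); exact: word_eq_relator.
    rewrite !om_cat r1 mulg1 [X in _ + (X + _)](_ : _ = 0) ?add0r//.
    have := R3 _ Rr; move: r1.
    case: r {Rr} => [|l1 [|l2 [|l3 [|? ?]]]] //= r1 _.
    set z := (x * _)%g; rewrite addr0 addrA.
    have zE : (z * letter l1 * letter l2 * letter l3)%g = z.
      have {}r1 : (letter l1 * letter l2 * letter l3 = 1)%g.
        by rewrite -!mulgA -[letter l3]mulg1.
      by rewrite -2!mulgA [(letter l1 * _)%g]mulgA r1 mulg1.
    rewrite zE; apply: w3; [by exists l1|by exists l2|].
    by exists l3; rewrite zE.
have /choice [wd wdE] := word_val_onto.
exists (fun x => om 1%g (wd x)) => x y [l ->].
have -> : om 1%g (wd (x * letter l)%g) = om 1%g (wd x ++ [:: l]).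
  apply: om_eq; apply/presS; rewrite wdE word_val_cat wdE /=.
  by rewrite -/(letter l) mulg1.
by rewrite om_cat /= addr0 wdE mul1g addrAC subrr add0r.
Qed.

End potential.
(** * Level sets of a pseudocharacter *)

Section separation.
Context {R : realType} {G : groupType} (S : set G).
Hypothesis tri : triangular_generating_set S.
Variables (f : G -> R) (e : R).
Hypothesis fe : forall x y, adj S x y -> `|f x - f y| <= e.

Definition strip (lo hi : R) : set G := [set y | lo <= f y <= hi].

Definition band (D c : R) : set G := strip (D - c) (D + c).

(** [K] is a union of components of the band of half-width [e] around [D], as far as
    vertices of this band are concerned. *)
Definition level_closed (D : R) (K : set G) : Prop :=
  forall x y, adj S x y -> band D e x -> band D e y -> K x -> K y.

Definition above (D : R) (x : G) : int := Posz (D <= f x)%R.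

Lemma crossing_band D x y :
  adj S x y -> above D x <> above D y -> band D e x /\ band D e y.
Proof.
move=> /fe; rewrite /above /band /strip /= ler_norml => /andP[h1 h2].
by case: (lerP D (f x)) => ?; case: (lerP D (f y)) => ? // _; lra.
Qed.

(** The potential counts the signed crossings of the level [D] that occur in [K]. *)
Lemma potential D K : level_closed D K ->
  exists h : G -> int,
  [/\ forall x y, adj S x y -> ~ (K x /\ K y) -> h x = h y,
      forall x y, adj S x y -> above D x = above D y -> h x = h y &
      forall x y, adj S x y -> K x -> K y ->
        h x - above D x = h y - above D y].
Proof.
move=> Kcl.
pose w x y : int := if `[< K x /\ K y >] then above D y - above D x else 0.
have wE x y : K x -> K y -> w x y = above D y - above D x.
  by move=> Kx Ky; rewrite /w asboolT.
have w0 x y : ~ (K x /\ K y) -> w x y = 0 by move=> nK; rewrite /w asboolF.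
have wN x y : w y x = - w x y.
  have [[Kx Ky]|nK] := pselect (K x /\ K y); first by rewrite !wE// opprB.
  by rewrite !w0 ?oppr0// => -[Ky Kx]; exact: nK.
(* An edge of [K] whose ends are on different sides of the level [D] forces the
   third vertex of each of its triangles into [K]. *)
have w2 x y z : adj S x y -> adj S y z -> adj S z x -> K x -> K y -> ~ K z ->
    w x y + w y z + w z x = 0.
  move=> xy yz zx Kx Ky nKz.
  rewrite (w0 y z) ?(w0 z x) ?addr0; [|by case|by case]; rewrite wE//.
  have [->|xyD] := pselect (above D x = above D y); first by rewrite subrr.
  have [Bx By] := crossing_band xy xyD; exfalso; apply: nKz.
  have [xzD|/(crossing_band zx)[Bz _]] := pselect (above D z = above D x).
    have [|_ Bz] := @crossing_band D _ _ yz; last exact: Kcl yz By Bz Ky.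
    by rewrite xzD => yx; apply: xyD.
  exact: Kcl yz By Bz Ky.
have [||h hE] := exact_cochain tri (w := w); first exact: wN.
  move=> x y z xy yz zx.
  have [Kx|nKx] := pselect (K x); have [Ky|nKy] := pselect (K y);
    have [Kz|nKz] := pselect (K z).
  - by rewrite !wE//; ring.
  - exact: w2.
  - by rewrite -(w2 _ _ _ zx xy yz Kz Kx nKy); ring.
  - by rewrite !w0 ?addr0//; case.
  - by rewrite -(w2 _ _ _ yz zx xy Ky Kz nKx); ring.
  - by rewrite !w0 ?addr0//; case.
  - by rewrite !w0 ?addr0//; case.
  - by rewrite !w0 ?addr0//; case.
exists h; split=> x y xy.
- by move=> nK; apply/esym/eqP; rewrite -subr_eq0 hE// w0.
- move=> xyD; apply/esym/eqP; rewrite -subr_eq0 hE//.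
  by rewrite /w xyD; case: ifP; rewrite ?subrr.
- move=> Kx Ky; have := hE _ _ xy; rewrite wE// => hxy.
  by rewrite -(subrK (h x) (h y)) hxy; ring.
Qed.

(** The potential of [K] jumps by one along a path that leads from below [D] to above
    [D] and crosses this level only within [K], while it does not change along a path
    that avoids [K]. *)
Lemma separation D K u v : level_closed D K -> f u < D <= f v ->
  reach S [set y | band D e y -> K y] u v -> ~ reach S (~` K) u v.
Proof.
move=> Kcl /andP[uD Dv] uv uv'.
have [h [h1 h2 h3]] := potential Kcl.
have huv : h u = h v by apply: reach_const uv' => a b ab nKa _; apply: h1 => // -[].
have : h u - above D u = h v - above D v.
  apply: (reach_const (u := fun a => h a - above D a)) uv => a b ab Ka Kb.
  have [abD|/(crossing_band ab)[Ba Bb]] := pselect (above D a = above D b).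
    by rewrite abD (h2 _ _ ab).
  by apply: h3 => //; [exact: Ka|exact: Kb].
by rewrite huv /above Dv leNgt uD /= => /addrI/eqP.
Qed.

End separation.

Section pseudo.
Context {R : realType} {G : groupType} {S : set G}.
Hypothesis tri : triangular_generating_set S.

Section basic.
Variable f : G -> R.
Hypothesis hf : pseudocharacter f.

Lemma pseudoX x n : f (x ^+ n)%g = n%:R * f x.
Proof. by have [/(_ x n%:Z)] := hf. Qed.

Lemma pseudo1 : f 1%g = 0.
Proof. by have := pseudoX 1%g 0; rewrite expg0 mul0r. Qed.

Lemma pseudoV x : f x^-1%g = - f x.
Proof. by have [/(_ x (Negz 0))/= -> _] := hf; rewrite mulN1r. Qed.

Lemma pseudoN : pseudocharacter (fun x => - f x).
Proof.
have [hX [C hC]] := hf; split=> [a n|]; first by rewrite hX mulrN.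
by exists C => a b; rewrite -!opprD normrN.
Qed.

Lemma pseudo_defect : exists2 d : R, 0 <= d &
  forall a b, f a + f b - d <= f (a * b)%g <= f a + f b + d.
Proof.
have [_ [C hC]] := hf; exists C; first exact: le_trans (normr_ge0 _) (hC 1%g 1%g).
by move=> a b; have := hC a b; rewrite ler_norml => /andP[? ?]; lra.
Qed.

Lemma edge_bound : exists2 e : R, 0 <= e & forall x y, adj S x y -> `|f x - f y| <= e.
Proof.
have [/finite_seqP[s sE] _] := tri; have [d d0 fd] := pseudo_defect.
exists (\sum_(t <- s) `|f t| + d); first by rewrite addr_ge0// sumr_ge0.
move=> x y [[t b] ->].
have sS x' : S x' -> x' \in s by rewrite sE.
have ts := sS _ (set_mem (valP t)).
have fl : `|f (letter (t, b))| <= \sum_(t <- s) `|f t|.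
  have -> : `|f (letter (t, b))| = `|f (\val t)|.
    by rewrite /letter /=; case: b; rewrite ?pseudoV ?normrN.
  by rewrite (big_rem _ ts) /= lerDl sumr_ge0.
have := fd x (letter (t, b)); move: fl; rewrite !ler_norml.
by move=> /andP[? ?] /andP[? ?]; lra.
Qed.

Lemma reach_bounded x y : exists B : R, reach S (strip f (- B) B) x y.
Proof.
elim: (reachT tri x y) => [_|{}y z _ [B xy] yz _].
  by exists `|f x|; apply: reach_refl; rewrite /strip /= -ler_norml.
exists (Num.max B `|f z|); apply: reach_step yz _.
  apply: reach_sub xy => t; rewrite /strip /= -!ler_norml => tB.
  by rewrite le_max tB.
by rewrite /strip /= -!ler_norml le_max lexx orbT.
Qed.

(** Right translation by a fixed element is realized by paths of bounded height
    variation, since the left action shifts heights up to a bounded error. *)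
Lemma reach_mulr t : exists2 B : R, 0 <= B &
  forall x, reach S (strip f (f x - B) (f x + B)) x (x * t)%g.
Proof.
have [d d0 fd] := pseudo_defect; have [B h] := reach_bounded 1%g t.
have B0 : 0 <= B by have := reach_start h; rewrite /strip /= pseudo1 => /andP[].
exists (B + d) => [|x]; first exact: addr_ge0.
rewrite -{3}(mulg1 x); apply: reach_mull h => z; rewrite /strip /= => /andP[? ?].
by have /andP[? ?] := fd x z; lra.
Qed.

End basic.

(** * Ends of axes *)

Section axis.
Variables (f : G -> R) (g : G).
Hypotheses (hf : pseudocharacter f) (fg : 0 < f g).

Lemma axis_height : exists2 d : R, 0 <= d & forall x n,
  f x + n%:R * f g - d <= f (x * g ^+ n)%g <= f x + n%:R * f g + d.
Proof.
have [d d0 fd] := pseudo_defect hf.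
by exists d => // x n; have := fd x (g ^+ n)%g; rewrite pseudoX.
Qed.

Lemma axis_level : exists2 c : R, 0 <= c & forall x (D : R), f x <= D ->
  exists n, band f D c (x * g ^+ n)%g.
Proof.
have [d d0 fd] := axis_height.
exists (d + f g) => [|x D xD]; first by rewrite addr_ge0// ltW.
exists (Num.truncn ((D - f x) / f g)).
have /truncn_itv : 0 <= (D - f x) / f g by rewrite divr_ge0 ?subr_ge0// ltW.
set n := Num.truncn _; rewrite ler_pdivlMr// ltr_pdivrMr// => /andP[n1 n2].
have := fd x n; rewrite -natr1 mulrDl mul1r in n2 *.
by rewrite /band /strip /= => /andP[? ?]; lra.
Qed.

Lemma axis_path : exists2 B : R, 0 <= B & forall x n,
  reach S [set y | exists2 m, (m <= n)%N &
    reach S (strip f (f (x * g ^+ m)%g - B) (f (x * g ^+ m)%g + B))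
      (x * g ^+ m)%g y] x (x * g ^+ n)%g.
Proof.
have [B B0 hB] := reach_mulr hf g; exists B => // x n.
have h m : strip f (f (x * g ^+ m)%g - B) (f (x * g ^+ m)%g + B) (x * g ^+ m)%g.
  by rewrite /strip /=; lra.
elim: n => [|n IH].
  rewrite expg0 mulg1; apply: reach_refl; exists 0%N => //.
  by rewrite expg0 mulg1; apply: reach_refl; rewrite /strip /=; lra.
apply: (@reach_trans _ _ _ _ (x * g ^+ n)%g).
  by apply: reach_sub IH => y [m mn ?]; exists m => //; rewrite (leq_trans mn).
have := hB (x * g ^+ n)%g; rewrite -mulgA -expgSr.
by move=> /reach_reach; apply: reach_sub => y; exists n.
Qed.

(** Heights grow along an axis up to a bounded error, so that the axis between two
    points stays between their heights up to a bounded error. *)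
Lemma axis_strip : exists2 B : R, 0 <= B & forall x i j lo hi,
  strip f lo hi (x * g ^+ i)%g -> strip f lo hi (x * g ^+ j)%g ->
  reach S (strip f (lo - B) (hi + B)) (x * g ^+ i)%g (x * g ^+ j)%g.
Proof.
have [B B0 hB] := axis_path; have [d d0 hd] := axis_height.
exists (B + 4 * d) => [|x i j lo hi]; first by rewrite addr_ge0// mulr_ge0.
wlog ij : i j / (i <= j)%N => [th Pi Pj|].
  have [ij|/ltnW ji] := leqP i j; first exact: th.
  by apply: reach_sym; apply: th.
move=> Pi Pj; have := hB (x * g ^+ i)%g (j - i)%N.
rewrite -mulgA -expgnDr subnKC//.
apply: reach_sub => y [m mij /reach_end].
rewrite -mulgA -expgnDr; move: Pi Pj; rewrite /strip /= => /andP[Pi1 Pi2] /andP[Pj1 Pj2].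
have /andP[i1 i2] := hd x i; have /andP[j1 j2] := hd x j.
have /andP[m1 m2] := hd x (i + m)%N.
have im : i%:R * f g <= (i + m)%:R * f g.
  by rewrite ler_pM2r// ler_nat leq_addr.
have mj : (i + m)%:R * f g <= j%:R * f g.
  by rewrite ler_pM2r// ler_nat -leq_subRL.
by move=> /andP[? ?]; lra.
Qed.

(** The equivalence of rays, restricted to the orbits [x g^n].  Since it is a
    left-invariant equivalence relation, the elements that fix the end of [g] form a
    subgroup. *)
Definition same_end (x y : G) : Prop :=
  exists C : R, forall D : R, C < D ->
    exists i j, reach S (band f D C) (x * g ^+ i)%g (y * g ^+ j)%g.

Lemma band_sub D c c' : c <= c' -> forall z, band f D c z -> band f D c' z.
Proof. by move=> cc z; rewrite /band /strip /= => /andP[? ?]; lra. Qed.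

Lemma same_end_refl x : same_end x x.
Proof.
have [c c0 hc] := axis_level; exists (c + `|f x|) => D xD.
have xD' : f x <= D by have := ler_norm (f x); lra.
have [n nD] := hc x D xD'; exists n, n; apply: reach_refl.
by apply: band_sub nD; rewrite lerDl.
Qed.

Lemma same_end_sym x y : same_end x y -> same_end y x.
Proof.
move=> [C hC]; exists C => D /hC[i [j xy]]; exists j, i; exact: reach_sym.
Qed.

Lemma same_end_trans x y z : same_end x y -> same_end y z -> same_end x z.
Proof.
move=> [C1 h1] [C2 h2]; have [B B0 hB] := axis_strip.
exists (Num.max C1 C2 + B) => D CD.
have C1m : C1 <= Num.max C1 C2 by rewrite le_max lexx.
have C2m : C2 <= Num.max C1 C2 by rewrite le_max lexx orbT.
have [|i [j xy]] := h1 D; first lra.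
have [|j' [k yz]] := h2 D; first lra.
exists i, k; apply: reach_trans (reach_sub _ xy) _.
  by apply: band_sub; lra.
apply: reach_trans (reach_sub _ yz); last by apply: band_sub; lra.
have Pj := band_sub C1m (reach_end xy); have Pj' := band_sub C2m (reach_start yz).
have := hB _ _ _ _ _ Pj Pj'; apply: reach_sub => t.
by rewrite /band /strip /= => /andP[? ?]; lra.
Qed.

Lemma same_end_mull z x y : same_end x y -> same_end (z * x)%g (z * y)%g.
Proof.
move=> [C hC]; have [d d0 fd] := pseudo_defect hf.
exists (C + d + `|f z|) => D CD; have zn := ler_norm (f z).
have [|i [j xy]] := hC (D - f z); first lra.
exists i, j; rewrite -!mulgA; apply: reach_mull xy => t.
have := normr_ge0 (f z).
by rewrite /band /strip /= => ? /andP[? ?]; have /andP[? ?] := fd z t; lra.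
Qed.

Lemma same_end_mul x y : same_end 1%g x -> same_end 1%g y -> same_end 1%g (x * y)%g.
Proof.
by move=> hx /(same_end_mull x); rewrite mulg1; exact: same_end_trans.
Qed.

Lemma same_endV x : same_end 1%g x -> same_end 1%g x^-1%g.
Proof. by move=> /(same_end_mull x^-1%g); rewrite mulg1 mulVg => /same_end_sym. Qed.

End axis.

End pseudo.
(** * Continuous paths in the Cayley graph *)

Section cayley_paths.
Context {R : realType} {G : groupType} {S : set G}.
Implicit Types (g : G) (s : S) (t : R) (P : set G) (U : set (cayley R S)).

Lemma edge_mapP g s t :
  (exists t01, edge_map g s t = Edge g s t t01) \/
  (~~ (0 < t < 1) /\
   edge_map g s t = if t <= 0 then Vertex g else Vertex (g * \val s)%g).
Proof.
pose val b (a : alt_spec (0 < t < 1) (0 < t < 1) b) : cayley R S :=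
  match a with
  | AltTrue t01 => Edge g s t t01
  | AltFalse _ => if t <= 0 then Vertex g else Vertex (g * \val s)%g
  end.
have H b (a : alt_spec (0 < t < 1) (0 < t < 1) b) :
    (exists t01, val b a = Edge g s t t01) \/
    (~~ (0 < t < 1) /\
     val b a = if t <= 0 then Vertex g else Vertex (g * \val s)%g).
  by destruct a as [h|h]; [left; exists h|right].
exact: (H _ (boolP _)).
Qed.

Lemma edge_map_le0 g s t : t <= 0 -> edge_map g s t = Vertex g.
Proof.
move=> t0; case: (edge_mapP g s t) => [[t01 _]|[_ ->]]; last by rewrite t0.
by move: t01; rewrite ltNge t0.
Qed.

Lemma edge_map_ge1 g s t : 1 <= t -> edge_map g s t = Vertex (g * \val s)%g.
Proof.
move=> t1; case: (edge_mapP g s t) => [[t01 _]|[_ ->]].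
  by move: t01; rewrite [t < 1]ltNge t1 andbF.
by rewrite leNgt (lt_le_trans ltr01 t1).
Qed.

Lemma edge_map_in g s t (t01 : 0 < t < 1) : edge_map g s t = Edge g s t t01.
Proof.
case: (edge_mapP g s t) => [[h ->]|[]]; last by rewrite t01.
by rewrite (bool_irrelevance h t01).
Qed.

Lemma edge_map_continuous g s : continuous (@edge_map R G S g s).
Proof. by apply/continuousP => U; exact. Qed.

(** The parametrization of an edge pulls such a [U] back to the empty set, to the open
    unit interval, or to the union of the latter with the half-lines that correspond
    to the ends in [U]. *)
Lemma open_star U :
  (forall g s t t' h h', U (Edge g s t h) -> U (Edge g s t' h')) ->
  (forall g s t h, U (Vertex g) \/ U (Vertex (g * \val s)%g) -> U (Edge g s t h)) ->
  open U.
Proof.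
move=> UE UV; suff: cayley_open U by [].
move=> g s.
have inE t : (edge_map g s @^-1` U) t <->
    [/\ t <= 0 -> U (Vertex g), 1 <= t -> U (Vertex (g * \val s)%g) &
        forall h, U (Edge g s t h)].
  rewrite /preimage /=; split=> [Ut|[U0 U1 Uh]].
    by split=> [t0|t1|h]; [rewrite edge_map_le0 in Ut|rewrite edge_map_ge1 in Ut
      |rewrite edge_map_in in Ut].
  have [t0|t0] := lerP t 0; first by rewrite edge_map_le0//; exact: U0.
  have [t1|t1] := lerP 1 t; first by rewrite edge_map_ge1//; exact: U1.
  have h : 0 < t < 1 by rewrite t0 t1.
  by rewrite edge_map_in.
have [|nM] := pselect (exists t h, U (Edge g s t h)); last first.
  rewrite (_ : _ @^-1` _ = set0); first exact: open0.
  apply/seteqP; split=> // t /inE[U0 U1 Uh]; apply: nM.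
  have h : 0 < (2^-1 : R) < 1 by apply/andP; split; lra.
  exists 2^-1, h; have [t0|t0] := lerP t 0; first by apply: UV; left; exact: U0.
  have [t1|t1] := lerP 1 t; first by apply: UV; right; exact: U1.
  have h' : 0 < t < 1 by rewrite t0 t1.
  exact: UE (Uh h').
move=> [t0 [h0 M]].
have [U0|U0] := pselect (U (Vertex g));
  have [U1|U1] := pselect (U (Vertex (g * \val s)%g)).
- rewrite (_ : _ @^-1` _ = setT); first exact: openT.
  by apply/seteqP; split=> // t _; apply/inE; split=> // h; exact: UE M.
- rewrite (_ : _ @^-1` _ = [set t | t < 1]); first exact: open_lt.
  apply/seteqP; split=> t /=.
    by move=> /inE[_ h1 _]; rewrite ltNge; apply/negP => /h1.
  move=> t1; apply/inE; split=> // [|h]; last exact: UE M.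
  by rewrite leNgt t1.
- rewrite (_ : _ @^-1` _ = [set t | t > 0]); first exact: open_gt.
  apply/seteqP; split=> t /=.
    by move=> /inE[h1 _ _]; rewrite ltNge; apply/negP => /h1.
  move=> t1; apply/inE; split=> // [|h]; last exact: UE M.
  by rewrite leNgt t1.
- rewrite (_ : _ @^-1` _ = [set t | t > 0] `&` [set t | t < 1]).
    by apply: openI; [exact: open_gt|exact: open_lt].
  apply/seteqP; split=> t /=.
    move=> /inE[h0' h1 _]; rewrite !ltNge.
    by split; apply/negP; [move=> /h0'|move=> /h1].
  move=> [t0' t1]; apply/inE; split=> // [||h]; last exact: UE M.
    by rewrite leNgt t0'.
  by rewrite leNgt t1.
Qed.

Lemma connected_split (T : topologicalType) (C U1 U2 : set T) :
  connected C -> open U1 -> open U2 -> C `<=` U1 `|` U2 ->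
  (forall p, C p -> U1 p -> U2 p -> False) -> C `&` U1 !=set0 -> C `<=` U1.
Proof.
move=> cC o1 o2 CU dis ne.
have <- : C `&` U1 = C.
  apply: cC => //; first by exists U1.
  exists (~` U2); first exact: open_closedC.
  apply/seteqP; split=> p /= [Cp Up]; split=> //; first by move=> /(dis _ Cp Up).
  by have [] := CU p Cp.
by move=> p [].
Qed.

Lemma ray_image_connected (phi : R -> cayley R S) a : 0 <= a -> continuous_ray phi ->
  connected (phi @` `[a, +oo[).
Proof.
move=> a0 cphi; apply: connected_continuous_connected.
  by apply/connected_intervalP; exact: interval_is_interval.
apply: continuous_subspaceW cphi => x /=; rewrite !in_itv/= !andbT; lra.
Qed.

Definition near (p : cayley R S) : G :=
  match p with Vertex g => g | Edge g _ _ _ => g end.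

(** Where [near] jumps along a ray, it jumps between the ends of an edge that the ray
    meets, and [u] takes the same value at both.  So the points of the ray near which
    [u] has a given value are those in a union of open stars, and so are the others;
    as a ray is connected, only one of the two sets is non-empty. *)
Lemma ray_const (phi : R -> cayley R S) T (u : G -> T) :
  continuous_ray phi ->
  (forall t g s h r, 0 <= r -> phi r = Edge g s t h -> u g = u (g * \val s)%g) ->
  forall r r', 0 <= r -> 0 <= r' -> u (near (phi r)) = u (near (phi r')).
Proof.
move=> cphi uphi r r' r0 r'0.
pose star (P : set G) : set (cayley R S) := [set p |
  match p with Vertex g => P g | Edge g s _ _ => P g \/ P (g * \val s)%g end].
have ostar P : open (star P) by apply: open_star => // g s t h; exact.
set a := u (near (phi r')).
suff: phi @` `[0, +oo[ `<=` star [set g | u g = a].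
  have phir : (phi @` `[0, +oo[) (phi r) by exists r => //; rewrite /= in_itv/= andbT.
  move=> /(_ _ phir); case E : (phi r) => [g|g s t h] //= [//|<-]; exact: uphi E.
apply: (@connected_split _ _ _ (star [set g | u g <> a])) => //.
- exact: ray_image_connected.
- move=> _ [x _ <-] /=; case: (phi x) => [g|g s t h] /=.
    by have [] := pselect (u g = a); [left|right].
  by have [] := pselect (u g = a); [left; left|right; left].
- move=> p [x /=]; rewrite in_itv/= andbT => x0; case: p => [g|g s t h] /= E //.
  by rewrite -(uphi _ _ _ _ _ x0 E) => -[] -> [].
- exists (phi r'); split; first by exists r' => //; rewrite /= in_itv/= andbT.
  by rewrite /a; case: (phi r') => [g|g s t h] //=; left.
Qed.

Section height.
Variable f : G -> R.

Lemma affine_ext_bound g s t h lo hi : strip f lo hi g ->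
  strip f lo hi (g * \val s)%g -> lo <= affine_ext f (@Edge R G S g s t h) <= hi.
Proof.
move=> /andP[a1 a2] /andP[b1 b2] /=; case/andP: h => t0 t1.
set a := f g in a1 a2 *; set b := f _ in b1 b2 *.
have -> : (1 - t) * a + t * b = a + t * (b - a) by ring.
by apply/andP; split; nra.
Qed.

Lemma near_height e p : (forall x y, adj S x y -> `|f x - f y| <= e) -> 0 <= e ->
  `|affine_ext f p - f (near p)| <= e.
Proof.
move=> fe e0; case: p => [g|g s t h]; first by rewrite /= subrr normr0.
have gs : adj S g (g * \val s)%g by exists (s, false).
have := fe _ _ gs; rewrite !ler_norml => /andP[? ?].
have b1 : strip f (f g - e) (f g + e) g by rewrite /strip /=; lra.
have b2 : strip f (f g - e) (f g + e) (g * \val s)%g by rewrite /strip /=; lra.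
by have /andP[? ?] := affine_ext_bound h b1 b2; apply/andP; rewrite /near; lra.
Qed.

(** The height is bounded on an edge, so that a ray of unbounded height leaves it,
    and by connectedness it does so through an end of the edge. *)
Lemma ray_hits_vertex (phi : R -> cayley R S) r g s t h :
  continuous_ray phi -> affine_ext f (phi t) @[t --> +oo] --> +oo ->
  0 <= r -> phi r = Edge g s t h ->
  exists2 r', 0 <= r' & phi r' = Vertex g \/ phi r' = Vertex (g * \val s)%g.
Proof.
move=> cphi phioo r0 phir; apply: contrapT => nohit.
pose U1 : set (cayley R S) := [set p | exists t h, p = Edge g s t h].
pose U2 : set (cayley R S) :=
  ~` (U1 `|` [set Vertex g; Vertex (g * \val s)%g]).
have CU : phi @` `[0, +oo[ `<=` U1.
  apply: (@connected_split _ _ _ U2).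
  - exact: ray_image_connected.
  - apply: open_star => [g' s' t1 t2 h1 h2 [t3 [h3 [-> -> _]]]|]; first by exists t2, h2.
    by move=> g' s' t' h' [|] [? [? ?]].
  - apply: open_star => [g' s' t1 t2 h1 h2 n1 n2|g' s' t' h' n1 n2].
      by apply: n1; left; case: n2 => [[t3 [h3 [-> -> _]]]|[|]//]; exists t1, h1.
    case: n2 => [[t3 [h3 [gE sE _]]]|[|]//]; subst g' s'.
    by case: n1 => n1; apply: n1; right; [left|right].
  - move=> p [x /=]; rewrite in_itv/= andbT => x0 xp.
    have [|n1] := pselect (U1 p); first by left.
    right=> -[//|[] pE]; apply: nohit; exists x => //; rewrite xp pE; by [left|right].
  - by move=> p _ p1; apply; left.
  - exists (phi r); split; first by exists r => //; rewrite /= in_itv/= andbT.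
    by exists t, h.
have [M hM] : exists M, forall p, U1 p -> affine_ext f p < M.
  exists (Num.max (f g) (f (g * \val s)%g) + 1) => _ [t' [h' ->]].
  set lo := Num.min (f g) (f (g * \val s)%g); set hi := Num.max (f g) _.
  have b1 : strip f lo hi g by rewrite /strip /= ge_min le_max !lexx.
  have b2 : strip f lo hi (g * \val s)%g.
    by rewrite /strip /= ge_min le_max !lexx !orbT.
  by have /andP[_ H] := affine_ext_bound h' b1 b2; rewrite (le_lt_trans H)// ltrDl.
have /cvgryPge/(_ M) := phioo.
move=> [A [_ hA]].
have x0 : 0 <= Num.max 0 (A + 1) by rewrite le_max lexx.
have := hA (Num.max 0 (A + 1)).
rewrite leNgt hM.
  by move=> /(_ _)/negP; rewrite lt_max ltrDl ltr01 orbT => /(_ isT).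
by apply: CU; exists (Num.max 0 (A + 1)) => //; rewrite /= in_itv/= andbT.
Qed.

End height.

End cayley_paths.
(** * Polygonal paths *)

Section polygons.
Context {R : realType} {G : groupType} {S : set G}.

Lemma continuous_compT (T U V : topologicalType) (h : T -> U) (k : U -> V) :
  continuous h -> continuous k -> continuous (fun x => k (h x)).
Proof. by move=> ch ck x; exact: (continuous_comp (ch x) (ck (h x))). Qed.

(** Constant outside [[0, 1]], so that segments can be glued at integer times. *)
Lemma segment_path (x y : G) : x = y \/ adj S x y ->
  exists gam : R -> cayley R S,
  [/\ continuous gam, forall t, t <= 0 -> gam t = Vertex x,
      forall t, 1 <= t -> gam t = Vertex y &
      forall (f : G -> R) t lo hi, strip f lo hi x -> strip f lo hi y ->
        lo <= affine_ext f (gam t) <= hi].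
Proof.
have edge_height (f : G -> R) g s t lo hi : strip f lo hi g ->
    strip f lo hi (g * \val s)%g -> lo <= affine_ext f (@edge_map R G S g s t) <= hi.
  case: (edge_mapP g s t) => [[t01 ->]|[_ ->]]; first exact: affine_ext_bound.
  by case: ifP.
case=> [->|[[s [] ->]]]; rewrite /letter /=.
- by exists (fun=> Vertex y); split=> //; move=> ?; exact: cvg_cst.
- exists (fun t => edge_map (x * (\val s)^-1)%g s (1 - t)); split=> [|t t0|t t1|].
  + apply: (continuous_compT (h := fun t : R => 1 - t)); last exact: edge_map_continuous.
    by move=> t; apply: cvgB; [exact: cvg_cst|exact: cvg_id].
  + by rewrite edge_map_ge1 ?mulgVK//; lra.
  + by rewrite edge_map_le0//; lra.
  + by move=> f t lo hi hx hy; apply: edge_height => //; rewrite mulgVK.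
- exists (edge_map x s); split=> [|t t0|t t1|f t lo hi hx hy].
  + exact: edge_map_continuous.
  + exact: edge_map_le0.
  + exact: edge_map_ge1.
  + exact: edge_height.
Qed.

Lemma polygon (v : nat -> G) : (forall n, v n = v n.+1 \/ adj S (v n) (v n.+1)) ->
  exists phi : R -> cayley R S,
  [/\ continuous phi, forall n : nat, phi n%:R = Vertex (v n) &
      forall (f : G -> R) t lo hi, strip f lo hi (v (Num.truncn t)) ->
        strip f lo hi (v (Num.truncn t).+1) -> lo <= affine_ext f (phi t) <= hi].
Proof.
move=> /(fun H n => segment_path (H n))/choice[gam gamP].
pose phi t := gam (Num.truncn t) (t - (Num.truncn t)%:R).
have phiE n t : n%:R <= t <= n.+1%:R -> phi t = gam n (t - n%:R).
  move=> /andP[nt tn]; have t0 : 0 <= t by rewrite (le_trans _ nt).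
  have [tn'|nt'] := ltP t n.+1%:R.
    suff trE : Num.truncn t = n by rewrite /phi trE.
    by apply/eqP; rewrite truncn_eq// nt.
  have {nt tn}-> : t = n.+1%:R by apply/eqP; rewrite eq_le tn nt'.
  rewrite /phi natrK subrr; have [_ -> // _ _] := gamP n.+1.
  have [_ _ -> //] := gamP n.
  by rewrite -natr1; lra.
exists phi; split=> [|n|f t lo hi lo1 hi1].
- have cN N : {within [set` `]-oo, N.+1%:R]], continuous phi}.
    elim: N => [|N IH].
      apply: (@subspace_eq_continuous _ _ _ (gam 0%N)); last first.
        by apply: continuous_subspaceT; case: (gamP 0%N).
      move=> t; rewrite inE /= in_itv/= => t1; change (gam 0%N t = phi t).
      have [t0|t0] := leP 0 t; first by rewrite (phiE 0%N) ?subr0// t0.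
      by rewrite /phi truncn_floor leNgt t0 /= subr0.
    rewrite (_ : [set` _] = [set` `]-oo, N.+1%:R]] `|` `[N.+1%:R, N.+2%:R]).
      apply: withinU_continuous => //; [exact: interval_closed|].
      apply: (@subspace_eq_continuous _ _ _ (fun t : R => gam N.+1 (t - N.+1%:R))).
        move=> t; rewrite inE /= in_itv/= => /phiE tE.
        by change (gam N.+1 (t - N.+1%:R) = phi t).
      apply: continuous_subspaceT.
      apply: (continuous_compT (h := fun t : R => t - N.+1%:R)).
        by move=> t; apply: cvgB; [exact: cvg_id|exact: cvg_cst].
      by case: (gamP N.+1).
    apply/seteqP; split=> t /=; rewrite !in_itv/=.
      by move=> tN; have [|/ltW] := leP t N.+1%:R; [left|right; rewrite tN andbT].
    by move=> [tN|/andP[]//]; apply: le_trans tN _; rewrite ler_nat.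
  move=> t; have [N tN] : exists N : nat, t < N.+1%:R.
    by exists (Num.truncn `|t|); rewrite (le_lt_trans (ler_norm t))// truncnS_gt.
  have : {within [set` `]-oo, N.+1%:R[], continuous phi}.
    apply: continuous_subspaceW (cN N) => x /=; rewrite !in_itv/=; exact: ltW.
  rewrite continuous_open_subspace; last exact: interval_open.
  by apply; rewrite inE /= in_itv.
- rewrite (phiE n) ?lexx ?ler_nat ?leqnSn//.
  by rewrite subrr; case: (gamP n) => _ + _ _; apply.
- by have [_ _ _] := gamP (Num.truncn t); apply.
Qed.

(** The continuous path of the definition of the equivalence of rays, obtained from
    an edge path. *)
Lemma reach_path (f : G -> R) D c x y : reach S (band f D c) x y ->
  exists delta : R -> cayley R S,
  [/\ {within `[0, 1], continuous delta}, delta 0 = Vertex x, delta 1 = Vertex y &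
      forall t, `|affine_ext f (delta t) - D| <= c].
Proof.
move=> /reach_seq[v [n [v0 vn vP vS]]].
have [|phi [cphi phin phif]] := polygon (v := v).
  by move=> i; have [->|] := vS i; [left|right].
exists (fun t => phi (t * n%:R)); split.
- apply: continuous_subspaceT.
  apply: (continuous_compT (h := fun t : R => t * n%:R)) => //.
  by move=> t; apply: cvgM; [exact: cvg_id|exact: cvg_cst].
- by rewrite mul0r (phin 0%N) v0.
- by rewrite mul1r phin vn.
- move=> t; have := phif f (t * n%:R) (D - c) (D + c) (vP _) (vP _).
  by rewrite ler_norml => /andP[? ?]; lra.
Qed.

Lemma sigma_pos (f : G -> R) (phi : R -> cayley R S) :
  sigma f phi = 1 <-> affine_ext f (phi t) @[t --> +oo] --> +oo.
Proof.
rewrite /sigma; split=> [|h]; last by rewrite asboolT.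
case: asboolP => //; case: asboolP => _ _; lra.
Qed.

Lemma sigma_neg (f : G -> R) (phi : R -> cayley R S) :
  sigma f phi = -1 <-> affine_ext f (phi t) @[t --> +oo] --> -oo.
Proof.
rewrite /sigma; split=> [|h].
  case: asboolP => [_ |_]; first lra.
  by case: asboolP => // _; lra.
rewrite asboolF ?asboolT// => /cvgryPge/(_ 1) h1.
move/cvgrNyPle : h => /(_ 0) h0.
have [t [h1t h0t]] : exists t, 1 <= affine_ext f (phi t) /\ affine_ext f (phi t) <= 0.
  by near (pinfty_nbhs R) => t; exists t; split; near: t.
lra.
Unshelve. all: by end_near.
Qed.

Lemma affine_extN (f : G -> R) (p : cayley R S) :
  affine_ext (fun x => - f x) p = - affine_ext f p.
Proof. by case: p => //= g s t _; ring. Qed.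

Lemma sigmaN (f : G -> R) (phi : R -> cayley R S) :
  sigma (fun x => - f x) phi = 1 <-> sigma f phi = -1.
Proof.
rewrite sigma_pos sigma_neg -cvgNry.
suff -> : (fun t => affine_ext (fun x => - f x) (phi t)) =
  - (fun t => affine_ext f (phi t)) by [].
by apply/funext => t; rewrite affine_extN.
Qed.

End polygons.
(** * Rays and axes *)

Section rays.
Context {R : realType} {G : groupType} {S : set G}.
Hypothesis tri : triangular_generating_set S.
Variables (f : G -> R) (g : G).
Hypotheses (hf : pseudocharacter f) (fg : 0 < f g).

(** The ray runs through the prefixes of the infinite power of a word for [g], each
    of which is a power of [g] times one of finitely many elements. *)
Lemma axis_ray : exists phi : R -> cayley R S, continuous_ray phi /\ sigma f phi = 1.
Proof.
have [w wE] := word_val_onto tri g.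
have [l0 _] : exists l0 : S * bool, True.
  case: w wE => [|l0 w] wE; last by exists l0.
  by move: fg; rewrite -wE /= (pseudo1 hf) ltxx.
set m := size w.
have m0 : (0 < m)%N.
  by rewrite /m; case: w wE {m} => // wE; move: fg; rewrite -wE /= (pseudo1 hf) ltxx.
pose v n := (g ^+ (n %/ m) * word_val (take (n %% m) w))%g.
have vS n : v n.+1 = (v n * letter (nth l0 w (n %% m)))%g.
  have nm : (n %% m < m)%N by rewrite ltn_mod.
  rewrite /v -mulgA.
  have -> : (word_val (take (n %% m) w) * letter (nth l0 w (n %% m)))%g =
      word_val (take (n %% m).+1 w).
    by rewrite (take_nth l0)// -cats1 word_val_cat /= mulg1.
  rewrite modnS divnS//; case: ifPn => [dv|_]; last by rewrite add0n.
  have -> : (n %% m).+1 = m.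
    apply/eqP; rewrite eqn_leq nm /=; apply: dvdn_leq => //.
    by rewrite /dvdn -addn1 modnDml addn1.
  by rewrite take0 /= mulg1 add1n expgSr take_size wE.
have [|phi [cphi _ phif]] := @polygon R G S v.
  by move=> n; right; exists (nth l0 w (n %% m)); exact: vS.
exists phi; split; first exact: continuous_subspaceT.
apply/sigma_pos/cvgryPge => A.
have [d d0 fd] := pseudo_defect hf.
pose M := \sum_(i < m) `|f (word_val (take i w))|.
have vh n : (n %/ m)%:R * f g - M - d <= f (v n).
  have nm : (n %% m < m)%N by rewrite ltn_mod.
  have : `|f (word_val (take (n %% m) w))| <= M.
    by rewrite /M (bigD1 (Ordinal nm)) //= lerDl sumr_ge0.
  rewrite ler_norml => /andP[? _].
  have := fd (g ^+ (n %/ m))%g (word_val (take (n %% m) w)).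
  by rewrite (pseudoX hf) => /andP[? _]; rewrite /v; lra.
pose N := (Num.truncn ((A + M + d) / f g)).+1.
have NA : A + M + d <= N%:R * f g.
  by rewrite -ler_pdivrMr//; apply: ltW; exact: truncnS_gt.
have vA n : (N * m <= n)%N -> A <= f (v n).
  move=> Nn; have Nd : (N <= n %/ m)%N by rewrite leq_divRL.
  have : N%:R * f g <= (n %/ m)%:R * f g by rewrite ler_pM2r// ler_nat.
  by have := vh n; lra.
near=> t.
have Nt : (N * m <= Num.truncn t)%N.
  by rewrite truncn_ge_nat; near: t; apply: nbhs_pinfty_ge; rewrite num_real.
set n := Num.truncn t in Nt *.
pose hi := Num.max (f (v n)) (f (v n.+1)).
have h1 : strip f A hi (v n) by rewrite /strip /= vA// le_max lexx.
have h2 : strip f A hi (v n.+1).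
  by rewrite /strip /= vA ?le_max ?lexx ?orbT// ltnW.
by have /andP[] := phif f t A hi h1 h2.
Unshelve. all: by end_near.
Qed.

Lemma ray_high (phi : R -> cayley R S) M : sigma f phi = 1 ->
  exists2 t, 0 <= t & M <= affine_ext f (phi t).
Proof.
move=> /sigma_pos/cvgryPge/(_ M) phiM.
near (pinfty_nbhs R) => t; exists t; near: t => //.
by apply: nbhs_pinfty_ge; rewrite num_real.
Unshelve. all: by end_near.
Qed.

(** Let [K] consist of the components of the level [D] that a ray [phi] meets.  The
    potential of [K] rises by one along [phi].  If [psi] does not meet [K], then the
    potential is constant along [psi]; but both rays start in a common component
    below [D], and if all axes have the same end then they also reach a common
    component above [D]. *)
Lemma rays_sim (phi psi : R -> cayley R S) :
  (forall x y, same_end (S := S) f g x y) ->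
  continuous_ray phi -> sigma f phi = 1 -> continuous_ray psi -> sigma f psi = 1 ->
  ray_sim f phi psi.
Proof.
move=> same cphi sphi cpsi spsi.
have [e e0 fe] := edge_bound tri hf.
have [B B0 hB] := axis_strip tri hf fg.
have [B1 low] := reach_bounded tri f (near (phi 0)) (near (psi 0)).
have B10 : 0 <= B1 by have := reach_start low; rewrite /strip /= => /andP[? ?]; lra.
exists (B1 + e + 1) => [|]; first lra.
split=> [|D]; first by rewrite sphi spsi.
rewrite sphi mul1r => DC.
pose K : set G := [set x | exists t v,
  [/\ 0 <= t, phi t = Vertex v & reach S (band f D e) v x]].
have [[t' [v' [t'0 psit' [t [v [t0 phit vv']]]]]]|noK] :=
    pselect (exists t' v', [/\ 0 <= t', psi t' = Vertex v' & K v']).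
  have [delta [cd d0 d1 df]] := reach_path vv'; exists delta; split=> //.
  - by rewrite d0; exists t; rewrite //= in_itv/= t0.
  - by rewrite d1; exists t'; rewrite //= in_itv/= t'0.
  - by move=> r _; apply: le_trans (df r) _; lra.
have Kcl : level_closed S f e D K.
  move=> x y xy _ By [t [v [t0 phit vx]]]; exists t, v; split=> //.
  exact: reach_step xy By.
have [h [h1 h2 h3]] := potential tri fe Kcl.
have edge p (s : S) : adj S p (p * \val s)%g by exists (s, false).
have hphi r r' : 0 <= r -> 0 <= r' ->
    h (near (phi r)) - above f D (near (phi r)) =
    h (near (phi r')) - above f D (near (phi r')).
  move: r r'; apply: (ray_const (u := fun p => h p - above f D p) cphi).
  move=> t p s t01 r r0 phir; have ps := edge p s.
  have [aE|aN] := pselect (above f D p = above f D (p * \val s)%g).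
    by rewrite aE (h2 _ _ ps aE).
  have [Bp Bs] := crossing_band fe ps aN.
  have [r' r'0 hit] := ray_hits_vertex cphi ((sigma_pos f phi).1 sphi) r0 phir.
  apply: h3 => //; case: hit => phir'; exists r'.
  - by exists p; split=> //; exact: reach_refl.
  - by exists (p * \val s)%g; split=> //; apply: reach_edge => //; exact: adj_sym.
  - by exists p; split=> //; exact: reach_edge.
  - by exists (p * \val s)%g; split=> //; exact: reach_refl.
have hpsi r r' : 0 <= r -> 0 <= r' -> h (near (psi r)) = h (near (psi r')).
  move: r r'; apply: (ray_const cpsi) => t p s t01 r r0 psir.
  apply: h1 => // -[Kp Ks]; apply: noK.
  have [r' r'0 [] hit] := ray_hits_vertex cpsi ((sigma_pos f psi).1 spsi) r0 psir.
    by exists r', p.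
  by exists r', (p * \val s)%g.
have hi_eq (P : set G) x y : (forall z, P z -> D <= f z) -> reach S P x y -> h x = h y.
  move=> PD; apply: reach_const => a b ab Pa Pb; apply: h2 => //.
  by rewrite /above !PD.
have hlow : h (near (phi 0)) = h (near (psi 0)).
  have below z : strip f (- B1) B1 z -> (D <= f z) = false.
    by move=> /andP[_ ?]; apply/negbTE; rewrite -ltNge; lra.
  apply: reach_const low => a b ab Ba Bb; apply: h2 => //.
  by rewrite /above !below.
have top (chi : R -> cayley R S) : sigma f chi = 1 ->
    exists2 t, 0 <= t & D + B <= f (near (chi t)).
  move=> schi; have [t t0 tM] := ray_high (D + B + e) schi; exists t => //.
  have := near_height (chi t) fe e0; rewrite ler_norml => /andP[? ?]; lra.
have [t t0 xD] := top phi sphi; have [t' t'0 yD] := top psi spsi.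
set x := near (phi t) in xD *; set y := near (psi t') in yD *.
have climb z i : D + B <= f z -> D + B <= f (z * g ^+ i)%g -> h z = h (z * g ^+ i)%g.
  move=> zD ziD.
  have := hB z 0%N i (D + B) (Num.max (f z) (f (z * g ^+ i)%g)).
  rewrite expg0 mulg1 /strip /= zD ziD !le_max !lexx orbT => /(_ isT isT).
  by apply: hi_eq => u /andP[? _]; lra.
have hxy : h x = h y.
  have [C1 hC1] := same x y.
  (* High enough for the band of half-width [C1] around it to lie above [D + B]. *)
  pose D' := Num.max C1 (D + B + C1) + 1.
  have m1 : C1 <= Num.max C1 (D + B + C1) by rewrite le_max lexx.
  have m2 : D + B + C1 <= Num.max C1 (D + B + C1) by rewrite le_max lexx orbT.
  have [|i [j xy]] := hC1 D'; first by rewrite /D'; lra.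
  have bD z : band f D' C1 z -> D + B <= f z.
    by rewrite /band /strip /= /D' => /andP[? _]; lra.
  rewrite (climb x i) ?(climb y j)//; try by apply: bD; apply: reach_end xy.
    by apply: hi_eq xy => z /bD; lra.
  by apply: bD; apply: reach_start xy.
have := hphi t 0 t0 (lexx 0); rewrite -/x hxy /y (hpsi t' 0 t'0 (lexx 0)) -hlow.
have Dx : D <= f x by lra.
have D0 : f (near (phi 0)) < D.
  by have /andP[_ ?] := reach_start low; lra.
by rewrite /above Dx leNgt D0 /= => /addrI/eqP.
Qed.

Lemma E_pos_singleton : (forall x y, same_end (S := S) f g x y) ->
  E_pos (S := S) f #= `I_1.
Proof.
move=> same; have [phi [cphi sphi]] := axis_ray.
have classE (chi : R -> cayley R S) : continuous_ray chi -> sigma f chi = 1 ->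
    ray_class f chi = [set psi | continuous_ray psi /\ sigma f psi = 1].
  move=> cchi schi; apply/seteqP; split=> psi /= [cpsi].
    by move=> [C _ [<- _]].
  by move=> spsi; split=> //; exact: rays_sim.
rewrite (_ : E_pos f = [set ray_class f phi]); first exact: card_set1.
apply/seteqP; split=> [_ [chi [cchi schi] <-]|_ ->] /=; last by exists phi.
by rewrite !classE.
Qed.

Lemma separate_axes : ~ (E_pos (S := S) f #= `I_1) ->
  exists k, ~ same_end (S := S) f g 1%g k.
Proof.
move=> nE; apply: contrapT => /forallNP same; apply/nE/E_pos_singleton => x y.
have /contrapT/(same_end_mull hf x) := same (x^-1 * y)%g.
by rewrite mulg1 mulVKg.
Qed.

End rays.

Lemma E_negN (R : realType) (G : groupType) (S : set G) (f : G -> R) :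
  E_pos (S := S) (fun x => - f x) = E_neg (S := S) f.
Proof.
have simN (phi psi : R -> cayley R S) : sigma f phi = -1 ->
    ray_sim (fun x => - f x) phi psi <-> ray_sim f phi psi.
  move=> sphi; have sphi' := (sigmaN f phi).2 sphi.
  have sE : sigma (fun x => - f x) phi = sigma (fun x => - f x) psi <->
      sigma f phi = sigma f psi.
    rewrite sphi sphi'.
    by split=> /esym h; apply/esym; [exact/sigmaN|exact/sigmaN].
  split=> -[C C0 [s12 H]]; exists C => //; split; do ?exact/sE;
    move=> D; rewrite ?sphi ?sphi' ?mul1r ?mulN1r => CD.
  - have [|delta [cd d0 d1 df]] := H (- D); first by rewrite sphi' mul1r.
    exists delta; split=> // t t01; have := df t t01.
    by rewrite affine_extN -opprD normrN.
  - have [|delta [cd d0 d1 df]] := H (- D); first by rewrite sphi mulN1r opprK.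
    exists delta; split=> // t t01; have := df t t01.
    by rewrite affine_extN -normrN opprD opprK.
have clN (phi : R -> cayley R S) : sigma f phi = -1 ->
    ray_class (fun x => - f x) phi = ray_class f phi.
  by move=> sphi; apply/seteqP; split=> psi [cpsi /(simN _ _ sphi)].
apply/seteqP; split=> _ [phi [cphi sphi] <-].
  by move/sigmaN in sphi; exists phi => //; rewrite clN.
by exists phi; [split=> //; exact/sigmaN|rewrite clN].
Qed.
(** * Walls across an axis *)

Section walls.
Context {R : realType} {G : groupType} {S : set G}.
Hypothesis tri : triangular_generating_set S.
Variables (f : G -> R) (g : G) (e : R).
Hypotheses (hf : pseudocharacter f) (fg : 0 < f g).
Hypothesis e0 : 0 <= e.
Hypothesis fe : forall x y, adj S x y -> `|f x - f y| <= e.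

Definition wall (k : G) (D c : R) : set G :=
  [set x | exists j, reach S (band f D c) (k * g ^+ j)%g x].

Lemma wall_band k D c x : wall k D c x -> band f D c x.
Proof. by move=> [j] /reach_end. Qed.

(** The path follows a segment from the identity to [k], then the axis, and finally
    the wall.  It stays between the height of the identity and that of the wall, and
    near the level of the wall it meets only what is joined to the axis. *)
Lemma wall_path k : exists B0 : R, forall B D c : R,
  B0 <= B -> 0 <= c -> B + c < D ->
  forall q, wall k D c q ->
    reach S [set y | - B <= f y <= D + c + B /\
      (band f D c y -> exists m, reach S (band f D (c + B)) (k * g ^+ m)%g y)] 1%g q.
Proof.
have [B1 h1] := reach_bounded tri f 1%g k.
have [Bp Bp0 hp] := axis_path tri g hf.
have [d d0 hd] := axis_height g hf.
have /andP[fk1 fk2] := reach_end h1.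
exists (B1 + 2 * Bp + 2 * d) => B D c BB c0 Dc q [j jq].
have /andP[k1 k2] := reach_start jq.
have := reach_start h1; rewrite /strip /= (pseudo1 hf) => /andP[B11 B12].
apply: (reach_trans (y := k)); last apply: (reach_trans (y := (k * g ^+ j)%g)).
- apply: reach_sub h1 => y /andP[y1 y2]; split; first lra.
  by rewrite /band /strip /= => /andP[? ?]; lra.
- apply: reach_sub (hp k j) => y [m mj my]; have /andP[y1 y2] := reach_end my.
  have /andP[j1 j2] := hd k j; have /andP[m1 m2] := hd k m.
  have m0 : 0 <= m%:R * f g by rewrite mulr_ge0 ?ler0n// ltW.
  have mj' : m%:R * f g <= j%:R * f g by rewrite ler_pM2r// ler_nat.
  split; first lra.
  move=> /andP[b1 b2]; exists m; apply: reach_sub my => z /andP[z1 z2].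
  by rewrite /band /strip /=; lra.
- apply: reach_sub (reach_reach jq) => y jy; have /andP[b1 b2] := reach_end jy.
  split; first lra.
  by move=> _; exists j; apply: reach_sub jy => z; apply: band_sub; lra.
Qed.

(** The axis crosses the level [D] only near itself, hence within the wall, while the
    segments at both of its ends stay away from the level. *)
Lemma wall_separates k : exists B0 : R, forall B D c : R,
  B0 <= B -> e + B <= c -> B + c < D ->
  forall n, D + c + B <= n%:R * f g ->
    ~ reach S (~` wall k D c) 1%g (k * g ^+ n * k^-1)%g.
Proof.
have [B1 h1] := reach_bounded tri f 1%g k.
have [Bp Bp0 hp] := axis_path tri g hf.
have [B2 B20 h2] := reach_mulr tri hf k^-1%g.
have [d d0 hd] := axis_height g hf.
have /andP[fk1 fk2] := reach_end h1.
exists (B1 + 2 * Bp + d + B2 + 1) => B D c BB cB Dc n nD; have e0' := e0.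
have := reach_start h1; rewrite /strip /= (pseudo1 hf) => /andP[B11 B12].
have /andP[n1 n2] := hd k n.
apply: (separation tri fe (D := D)).
- move=> x y xy _ /andP[y1 y2] [j kx]; exists j; apply: reach_step kx xy _.
  by rewrite /band /strip /=; lra.
- rewrite (pseudo1 hf); have /andP[? ?] := reach_end (h2 (k * g ^+ n)%g); lra.
- apply: (reach_trans (y := k)); last apply: (reach_trans (y := (k * g ^+ n)%g)).
  + apply: reach_sub h1 => y /andP[y1 y2] /andP[? ?]; exfalso; lra.
  + apply: reach_sub (hp k n) => y [m mn my] /andP[y1 y2]; exists m.
    have /andP[? ?] := reach_end my; apply: reach_sub my => z /andP[z1 z2].
    by rewrite /band /strip /=; lra.
  + apply: reach_sub (h2 _) => y /andP[y1 y2] /andP[? ?]; exfalso; lra.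
Qed.

End walls.

(** * Ping-pong *)

Section pingpong.
Context {G : groupType}.

(** A half-space consists of the points that a wall separates from the identity;
    [K] is the wall at the positive end of the axis of [a] and [K'] the one at its
    negative end.  The last hypothesis on walls says that [a] carries [K'] beyond [K].
    A path from the identity to [a x] that avoids [K], followed by the translate of a
    path from [x] to the identity that avoids [K'], joins the identity to [a]; so the
    translate meets [K], and from there one returns to the identity without meeting
    [a K'].  This joins [a] to the identity in the complement of [a K']. *)
Lemma wall_shift (S : set G) (K K' : set G) a x :
  ~ reach S (~` K) 1%g a -> ~ reach S (~` K') 1%g a^-1%g ->
  (forall q, K q -> reach S [set y | ~ K' (a^-1 * y)%g] 1%g q) ->
  reach S (~` K') 1%g x -> ~ reach S (~` K) 1%g (a * x)%g.
Proof.
move=> sepK sepK' KK' x1 ax1.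
have aax : reach S [set y | ~ K' (a^-1 * y)%g] a (a * x)%g.
  by rewrite -[X in reach _ _ X _]mulg1; apply: reach_mull x1 => z; rewrite /= mulKg.
have [aax'|[q nKq aq]] := reach_exit (~` K) aax.
  by apply: sepK; apply: reach_trans ax1 (reach_sym aax').
apply: sepK'; rewrite -[1%g](mulVg a) -{2}[a^-1%g]mulg1.
have := reach_trans aq (reach_sym (KK' q (contrapT nKq))).
by apply: reach_mull.
Qed.

(** Half-spaces of disjoint walls are disjoint: when a path from the identity enters
    one wall, the point of entry is reached without meeting the other. *)
Lemma walls_cover (S : set G) (tri : triangular_generating_set S) (K K' : set G) x :
  ~ K 1%g -> (forall q, K q -> reach S (~` K') 1%g q) ->
  (forall q, K' q -> reach S (~` K) 1%g q) ->
  reach S (~` K) 1%g x \/ reach S (~` K') 1%g x.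
Proof.
move=> K1 KK' K'K; elim: (reachT tri 1%g x) => [_|{}x y _ IH xy _].
  by left; exact: reach_refl.
have [Ky|nKy] := pselect (K y); first by right; exact: KK'.
have [K'y|nK'y] := pselect (K' y); first by left; exact: K'K.
by case: IH => h; [left|right]; exact: reach_step xy _.
Qed.

Lemma word_eq_ctx (X : Type) (Rel : set (word X)) a b v w :
  word_eq Rel v w -> word_eq Rel (a ++ v ++ b) (a ++ w ++ b).
Proof.
elim=> [u|{}v {}w _ IH|u {}v {}w _ IH1 _ IH2|u {}v x c|u {}v r Rr].
- exact: word_eq_refl.
- exact: word_eq_sym.
- exact: word_eq_trans IH2.
- have := word_eq_cancel Rel (a ++ u) (v ++ b) x c.
  by rewrite -!catA.
- have := word_eq_relator (a ++ u) (v ++ b) Rr.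
  by rewrite -!catA.
Qed.

Variable X : set G.
Implicit Types (l : X * bool) (v w : word X).

Fixpoint reduced w : Prop :=
  if w is l :: w' then reduced w' /\ (if w' is l' :: _ then l' <> flip l else True)
  else True.

Lemma reduce w : exists2 v, reduced v & word_eq set0 w v.
Proof.
elim: w => [|l w [v rv wv]]; first by exists [::] => //; exact: word_eq_refl.
have lwv : word_eq set0 (l :: w) (l :: v).
  by have := word_eq_ctx [:: l] [::] wv; rewrite !cats0.
case: v rv wv lwv => [|l' v] rv wv lwv; first by exists [:: l].
have [l'E|nE] := pselect (l' = flip l); last by exists (l :: l' :: v).
exists v; first by case: rv.
apply: word_eq_trans lwv _; rewrite l'E.
by case: l {l'E} => x b; exact: (word_eq_cancel set0 [::] v x b).
Qed.

Lemma word_eq0_val v w : word_eq set0 v w -> word_val v = word_val w.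
Proof.
elim=> [//|//|u {}v {}w _ -> _ -> //|{}v {}w x b|//].
rewrite !word_val_cat; congr (_ * _)%g.
rewrite -[RHS]mul1g; congr (_ * _)%g; rewrite /= mulg1.
by rewrite -/(letter (x, b)) -/(letter (flip (x, b))) letter_flip mulgV.
Qed.

Definition word_inv w : word X := rev (map (@flip G X) w).

Lemma word_invK w : word_eq set0 (word_inv w ++ w) [::].
Proof.
elim: w => [|[x b] w IH]; first exact: word_eq_refl.
rewrite /word_inv /= rev_cons cat_rcons.
apply: word_eq_trans IH; rewrite -/(word_inv w).
have := word_eq_cancel set0 (word_inv w) w x (~~ b).
by rewrite negbK.
Qed.

Lemma reduced_in_domain (U : X * bool -> set G) :
  (forall l l' x, l <> l' -> U l x -> ~ U l' x) -> (forall l, ~ U l 1%g) ->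
  (forall l x, ~ U (flip l) x -> U l (letter l * x)%g) ->
  forall l w, reduced (l :: w) -> U l (word_val (l :: w)).
Proof.
move=> Udis U1 Ushift l w; elim: w l => [|l' w IH] l rw.
  by apply: Ushift; exact: U1.
case: rw => rw nE; have Ul' := IH _ rw; apply: Ushift; exact: Udis nE Ul'.
Qed.

(** A reduced word moves the identity into the domain of its first letter, while the
    identity belongs to no domain. *)
Lemma ping_pong (U : X * bool -> set G) :
  (forall l l' x, l <> l' -> U l x -> ~ U l' x) -> (forall l, ~ U l 1%g) ->
  (forall l x, ~ U (flip l) x -> U l (letter l * x)%g) ->
  free_subgroup (range (@word_val G X)).
Proof.
move=> Udis U1 Ushift; exists X; split=> // v w; split; last exact: word_eq0_val.
move=> vw; have [u ru vu] := reduce (v ++ word_inv w).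
have : word_val u = 1%g.
  rewrite -(word_eq0_val vu) word_val_cat vw.
  have := word_eq0_val (word_invK w); rewrite word_val_cat => invw.
  apply: (mulIg (word_val w)).
  by rewrite -mulgA [(_ * word_val w)%g in LHS]invw mulg1 mul1g.
case: u ru vu => [_ vu _|l u ru _ u1]; last first.
  by exfalso; apply: (U1 l); rewrite -u1; exact: reduced_in_domain ru.
have := word_eq_ctx [::] w vu; rewrite /= -catA => h.
apply: word_eq_trans h; apply: word_eq_sym.
by have := word_eq_ctx v [::] (word_invK w); rewrite !cats0.
Qed.

End pingpong.
(** * Free subgroups from two axes *)

Section two_axes.
Context {R : realType} {G : groupType} {S : set G}.
Hypothesis tri : triangular_generating_set S.
Variables (f : G -> R) (g k : G).
Hypotheses (hf : pseudocharacter f) (fg : 0 < f g).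

Let F (s : bool) : G -> R := if s then (fun x => - f x) else f.
Let t (s : bool) : G := if s then g^-1%g else g.
Let b (i : bool) : G := if i then k else 1%g.

Let hF s : pseudocharacter (F s).
Proof. by case: s => //; exact: pseudoN. Qed.

Let Ft s : F s (t s) = f g.
Proof. by case: s; rewrite /= ?(pseudoV hf) ?opprK. Qed.

(** The walls have index [(s, i)]: [s] tells the end of the axis, as the positive end
    of [F s], and [i] tells the axis, that of [g] or of its conjugate by [k]. *)
Lemma free_of_separate_axes :
  (forall s, ~ same_end (S := S) (F s) (t s) 1%g k) ->
  exists H : set G,
    free_subgroup H /\ exists a b : G, [/\ H a, H b & (a * b)%g <> (b * a)%g].
Proof.
move=> sep; have [e e0 fe] := edge_bound tri hf.
have Fe s x y : adj S x y -> `|F s x - F s y| <= e.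
  by case: s => xy /=; rewrite ?fe// -opprD normrN; exact: fe.
have Ft0 s : 0 < F s (t s) by rewrite Ft.
have [d d0 fd] := pseudo_defect hf.
have [B [B0 hpath hwall]] : exists B : R, [/\ 0 <= B,
    forall s i (D c : R), 0 <= c -> B + c < D ->
      forall q, wall (S := S) (F s) (t s) (b i) D c q ->
      reach S [set y | - B <= F s y <= D + c + B /\ (band (F s) D c y ->
        exists m, reach S (band (F s) D (c + B)) (b i * t s ^+ m)%g y)] 1%g q &
    forall s i (D c : R), e + B <= c -> B + c < D ->
      forall n, D + c + B <= n%:R * f g ->
        ~ reach S (~` wall (S := S) (F s) (t s) (b i) D c) 1%g
          (b i * t s ^+ n * (b i)^-1)%g].
  have /choice[Bp hBp] (si : bool * bool) :=
    wall_path tri (hF si.1) (Ft0 si.1) (b si.2).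
  have /choice[Bw hBw] (si : bool * bool) :=
    wall_separates tri (t si.1) (hF si.1) e0 (@Fe si.1) (b si.2).
  pose M := \sum_(si : bool * bool) (`|Bp si| + `|Bw si|).
  have MB si : Bp si <= M /\ Bw si <= M.
    have : `|Bp si| + `|Bw si| <= M.
      by rewrite /M (bigD1 si) //= lerDl sumr_ge0// => ? _; rewrite addr_ge0.
    have := ler_norm (Bp si); have := ler_norm (Bw si).
    by have := normr_ge0 (Bp si); have := normr_ge0 (Bw si); split; lra.
  exists M; split=> [|s i D c c0 MD|s i D c Mc MD n].
  - by rewrite sumr_ge0// => ? _; rewrite addr_ge0.
  - by apply: (hBp (s, i)) => //; case: (MB (s, i)).
  - rewrite -(Ft s); apply: (hBw (s, i)) => //; by case: (MB (s, i)).
pose c := e + B.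
(* The axes are separated in a band of half-width [c + B], so that walls of half-width
   [c] stay disjoint from all points near the other axis. *)
have /choice[D hD] : forall s, exists D : R, c + B < D /\
    forall i j, ~ reach S (band (F s) D (c + B)) (1 * t s ^+ i)%g (k * t s ^+ j)%g.
  move=> s; have /forallNP/(_ (c + B))/existsNP[D /not_implyP[cD nD]] := sep s.
  by exists D; split=> // i j ij; apply: nD; exists i, j.
have Dc s : B + c < D s by have [] := hD s; lra.
have c0 : 0 <= c by rewrite addr_ge0.
(* Large enough to move each negative wall above the positive wall of its axis; the
   multiple of [d] pays for the defects of the products in the argument. *)
pose n := (Num.truncn ((D true + D false + 2 * c + 2 * B + 3 * d) / f g)).+1.
have nf : D true + D false + 2 * c + 2 * B + 3 * d < n%:R * f g.
  by rewrite -ltr_pdivrMr//; exact: truncnS_gt.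
pose K s i := wall (S := S) (F s) (t s) (b i) (D s) c.
pose a s i : G := (b i * t s ^+ n * (b i)^-1)%g.
have aV s i : ((a s i)^-1 = a (~~ s) i)%g.
  rewrite /a !invgM invgK mulgA -expVgn.
  by case: s => //=; rewrite invgK.
have FN s y : F (~~ s) y = - F s y by case: s; rewrite //= opprK.
(* Walls of different axes or at different ends do not meet, and each is reached
   from the identity without meeting the others. *)
have KK s i s' i' q : (s, i) <> (s', i') -> K s i q -> reach S (~` K s' i') 1%g q.
  move=> ne Kq; apply: reach_sub (hpath _ _ _ _ c0 (Dc s) _ Kq) => y /= [y1 y2] Ky.
  have By := wall_band Ky.
  have [ss|/eqP ss] := eqVneq s s'; last first.
    move: By y1; have -> : s' = ~~ s by case: (s) (s') ss => [] [].
    by rewrite /band /strip /= FN => /andP[? ?] /andP[? ?]; have := Dc (~~ s); lra.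
  subst s'; have {y2}[m my] := y2 By; have [j jy] := Ky.
  have {}jy : reach S (band (F s) (D s) (c + B)) (b i' * t s ^+ j)%g y.
    by apply: reach_sub jy => z; apply: band_sub; lra.
  case: i i' ne m j my jy {Kq Ky} => [] [] // _ m j my jy.
    by have [_ /(_ j m)] := hD s; apply; exact: reach_trans jy (reach_sym my).
  by have [_ /(_ m j)] := hD s; apply; exact: reach_trans my (reach_sym jy).
have K1 s i : ~ K s i 1%g.
  move=> /wall_band; rewrite /band /strip /= (pseudo1 (hF s)) => /andP[? _].
  by have := Dc s; lra.
have Dn s : D s + c + B <= n%:R * f g.
  by have := Dc true; have := Dc false; have := c0; have := B0; case: s; lra.
have shift s i x : reach S (~` K (~~ s) i) 1%g x ->
    ~ reach S (~` K s i) 1%g (a s i * x)%g.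
  apply: wall_shift; [|rewrite aV|].
  - exact: hwall.
  - exact: hwall.
  - move=> q Kq; apply: reach_sub (hpath _ _ _ _ c0 (Dc s) _ Kq) => y /= [/andP[_ y1] _].
    move=> /wall_band; rewrite /band /strip /= FN => /andP[_ y2].
    have Fd x' y' : F s x' + F s y' - d <= F s (x' * y')%g <= F s x' + F s y' + d.
      by have /andP[? ?] := fd x' y'; case: (s) => /=; lra.
    have /andP[h1 _] := Fd (a s i) ((a s i)^-1 * y)%g; rewrite mulVKg in h1.
    have /andP[h2 _] := Fd (b i * t s ^+ n)%g (b i)^-1%g; rewrite -/(a s i) in h2.
    have /andP[h3 _] := Fd (b i) (t s ^+ n)%g.
    rewrite (pseudoV (hF s)) in h2; rewrite (pseudoX (hF s)) Ft in h3.
    by case: (s) y1 y2 h1 h2 h3 => /=; lra.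
pose V s i : set G := [set x | ~ reach S (~` K s i) 1%g x].
have Vdis s i s' i' x : (s, i) <> (s', i') -> V s i x -> ~ V s' i' x.
  move=> ne; rewrite /V /= => n1; apply.
  have [|//] := walls_cover tri x (K1 s i) (KK _ _ _ _ ^~ ne) (KK _ _ _ _ ^~ (nesym ne)).
  by [].
have V1 s i : ~ V s i 1%g by apply; apply: reach_refl; exact: K1.
have Vshift s i x : ~ V (~~ s) i x -> V s i (a s i * x)%g.
  by move=> /contrapT; exact: shift.
pose x0 := a false false; pose x1 := a false true.
pose X : set G := [set x0; x1].
pose ind (l : X * bool) : bool := \val l.1 == x1.
have lE (l : X * bool) : letter l = a l.2 (ind l).
  case: l => x s; rewrite /letter /ind /=.
  have xE : \val x = a false (\val x == x1).
    have : X (\val x) by exact: set_mem (valP x).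
    by case: eqP => [->//|nx1] [].
  by case: s; rewrite {1}xE ?aV.
exists (range (@word_val G X)); split.
  apply: (ping_pong (U := fun l => V l.2 (ind l))) => [l l' x ll'|l|l x].
  - apply: Vdis => -[s2 i2]; apply: ll'.
    have XE (z : X) : \val z = if \val z == x1 then x1 else x0.
      have : X (\val z) by exact: set_mem (valP z).
      by case: eqP => [->//|nx1] [].
    case: l l' s2 i2 => [x' s'] [x'' s''] /= -> xx; congr (_, _).
    by apply: val_inj; rewrite (XE x') (XE x''); move: xx; rewrite /ind /= => ->.
  - exact: V1.
  - by rewrite lE /flip /=; exact: Vshift.
have X0 : X x0 by left. have X1 : X x1 by right.
exists x0, x1; split.
- by exists [:: (exist _ x0 (mem_set X0), false)] => //=; rewrite mulg1.
- by exists [:: (exist _ x1 (mem_set X1), false)] => //=; rewrite mulg1.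
- move=> x01; have := Vshift false false x1; rewrite -/x0 x01 => h0.
  have := Vshift false true x0; rewrite -/x1 => h1.
  have in1 : V false true x1.
    by rewrite -[x1]mulg1; apply: Vshift; exact: V1.
  have in0 : V false false x0.
    by rewrite -[x0]mulg1; apply: Vshift; exact: V1.
  apply: (Vdis false false false true (x1 * x0)%g) => //.
    by apply: h0; apply: Vdis in1.
  by apply: h1; apply: Vdis in0.
Qed.

End two_axes.

Theorem theorem3p9 (R : realType) (G : groupType) (hG : finitely_presented G)
    (S : set G) (hS : triangular_generating_set S)
    (f : G -> R) (hf : pseudocharacter f) (hf0 : exists g : G, f g != 0)
    (hb : bushy_type S f) :
  exists H : set G,
    free_subgroup H /\ exists a b : G, [/\ H a, H b & (a * b)%g <> (b * a)%g].
Proof.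
have [g fg] : exists g, 0 < f g.
  have [g] := hf0; case: (ltgtP (f g) 0) => // fg _; last by exists g.
  by exists g^-1%g; rewrite (pseudoV hf) oppr_gt0.
have [npos nneg] : ~ (E_pos (S := S) f #= `I_1) /\ ~ (E_neg (S := S) f #= `I_1).
  by have [nu nuni] := hb; split=> E1; apply: nuni; split=> //; [left|right].
have hf' := pseudoN hf.
have fg' : 0 < - f g^-1%g by rewrite (pseudoV hf) opprK.
have [k1 nk1] := separate_axes hS hf fg npos.
have [k2 nk2] : exists k, ~ same_end (S := S) (fun x => - f x) g^-1%g 1%g k.
  by apply: (separate_axes hS hf' fg'); rewrite E_negN.
(* The two stabilizers are proper subgroups, so that they do not cover [G]. *)
have [k [nkp nkn]] : exists k, ~ same_end (S := S) f g 1%g k /\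
    ~ same_end (S := S) (fun x => - f x) g^-1%g 1%g k.
  have [sk1|] := pselect (same_end (S := S) (fun x => - f x) g^-1%g 1%g k1);
    last by exists k1.
  have [sk2|] := pselect (same_end (S := S) f g 1%g k2); last by exists k2.
  exists (k1 * k2)%g; split=> s12.
    by apply: nk1; rewrite -(mulgK k2 k1); apply: same_end_mul => //; exact: same_endV.
  by apply: nk2; rewrite -(mulKg k1 k2); apply: same_end_mul => //; exact: same_endV.
by apply: (free_of_separate_axes hS (k := k) hf fg) => -[].
Qed.
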